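(* Let $k\ge 2$, let $p_1<p_2<\cdots<p_k$ be odd primes, and let $n=2p_1p_2\cdots p_k$. Then $\min\{\deg f(x): f(x)\in\mathcal{A}_n\}\le n-v$, where $$v=\begin{cases}\frac{n}{2}\cdot\frac{p_1+p_2}{p_1p_2}, & \text{if } 2p_1>p_2,\\ \frac{3n}{2p_2}, & \text{if } 2p_1<p_2<3p_1,\\ \frac{n}{2p_1}, & \text{if } 3p_1<p_2.\end{cases}$$
   Context: For a positive integer $n$, $\Phi_n(x)$ denotes the $n$-th cyclotomic polynomial and $\mathcal{A}_n$ is the set of polynomials $f(x)\in\mathbb{Z}[x]$ such that $\Phi_n(x)$ divides $f(x)$ and $f(x)=x^m-a_{m-1}x^{m-1}-\cdots-a_1x-1$ for some integer $m<n$ with $a_i\in\{0,1\}$ for $1\le i<m$. *)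

(* Defs.v *)
From mathcomp Require Import all_boot all_order all_algebra all_field.

Set Implicit Arguments.
Unset Strict Implicit.
Unset Printing Implicit Defensive.

Import Order.TTheory GRing.Theory Num.Theory.
Local Open Scope ring_scope.

(* Divisibility is taken in Z[x], not as the pseudo-divisibility %| of polydiv.
   The bound 0 < m makes x^m and the constant term -1 distinct monomials; m = 0
   would read as the zero polynomial. Only the values a i with 1 <= i < m matter. *)
Definition calA (n : nat) (f : {poly int}) : Prop :=
  (exists q : {poly int}, f = q * 'Phi_n) /\
  exists (m : nat) (a : nat -> int),
    [/\ (0 < m < n)%N,
        forall i : nat, (1 <= i < m)%N -> a i = 0 \/ a i = 1
      & f = 'X^m - \sum_(1 <= i < m) a i *: 'X^i - 1].

(* The degree of a nonzero polynomial; members of calA n are monic. *)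
Definition deg (f : {poly int}) : nat := (size f).-1.

Definition is_min_deg (A : {poly int} -> Prop) (d : nat) : Prop :=
  (exists f, A f /\ deg f = d) /\ (forall f, A f -> (d <= deg f)%N).

(* The boundary cases p2 = 2 * p1 and p2 = 3 * p1 cannot occur for odd primes
   p1 < p2, so the final branch is the case 3 * p1 < p2. *)
Definition vbound (n p1 p2 : nat) : rat :=
  if (p2 < 2 * p1)%N then n%:R / 2%:R * ((p1%:R + p2%:R) / (p1%:R * p2%:R))
  else if (p2 < 3 * p1)%N then (3%:R * n%:R) / (2%:R * p2%:R)
  else n%:R / (2%:R * p1%:R).

(* Main.v *)
Require Import Defs.
From mathcomp Require Import all_boot all_order all_algebra all_field.
From mathcomp Require Import zify ring.
From Stdlib Require Import Classical.

Set Implicit Arguments.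
Unset Strict Implicit.
Unset Printing Implicit Defensive.

Import Order.TTheory GRing.Theory Num.Theory.
Local Open Scope ring_scope.

(** Write p = p_1, q = p_2, n = 2 p q u, and let w be the u-th power of a
    primitive n-th root of unity, so that w^(pq) = -1.  The cosets
    {w^(c + 2 q j) : j < p} and {w^(c + 2 p j) : j < q} have zero sum.  Since
    w^m = - w^(m - pq), a relation w^m = 1 + (distinct powers of exponent < m)
    amounts to a zero sum of roots of unity that contains 1 and w^(m - pq) and
    whose exponents avoid [m, 2pq).
    - For m = 2pq - q, take the p-coset of 1.
    - If q < 2p and m = 2pq - p - q, add the p-coset of 1 to the q-coset of
      w^(-q): its only exponent in the forbidden range is -q, and w^(-q)
      cancels against the element w^(pq - q) of the p-coset.
    - If q > 2p and m = 2pq - 3p, add the q-coset of 1 to the p-coset of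
      w^(q - 2p): here w^(-2p) is the only offender and cancels against
      w^(pq - 2p).
    In the last two cases the two cosets have exponents of opposite parity, so
    the remaining exponents are distinct. *)

(** Reduces the theorem to exhibiting one member of [calA n] of degree n - v. Strong induction on
    the degree, with excluded middle deciding whether a member of smaller degree exists. *)
Lemma ex_min_deg (A : {poly int} -> Prop) (f : {poly int}) :
  A f -> exists2 d, is_min_deg A d & (d <= deg f)%N.
Proof.
move def_d: (deg f) => d; elim/ltn_ind: d f def_d => d IHd f def_d Af.
case: (classic (exists2 g, A g & (deg g < d)%N)) => [[g Ag lt_gd] | no_g].
  have [e min_e le_eg] := IHd _ lt_gd g erefl Ag.
  by exists e => //; apply: leq_trans le_eg (ltnW lt_gd).
exists d => //; split=> [|g Ag]; first by exists f.
by rewrite leqNgt; apply/negP=> lt_gd; apply: no_g; exists g.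
Qed.

(** Over Q, ['Phi_n] is the minimal polynomial of [z], hence divides [f]; since it is monic, the
    quotient can be taken in Z[x]. *)
Lemma Cyclotomic_dvd (n : nat) (z : algC) (f : {poly int}) :
  n.-primitive_root z -> root (map_poly (intr : int -> algC) f) z ->
  exists q : {poly int}, f = q * 'Phi_n.
Proof.
move=> prim_z fz0.
have ratr_intr (g : {poly int}) :
    map_poly (intr : int -> algC) g
      = map_poly (ratr : rat -> algC) (map_poly (intr : int -> rat) g).
  by rewrite -map_poly_comp; apply: eq_map_poly => x /=; rewrite ratr_int.
have [r [def_r _] dvd_r] := minCpolyP z.
have dvd_Phi : 'Phi_n %| f.
  rewrite -dvdp_rat_int.
  suff -> : map_poly (intr : int -> rat) 'Phi_n = r by rewrite -dvd_r -ratr_intr.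
  apply: (map_poly_inj (ratr : rat -> algC)).
  by rewrite -ratr_intr -def_r (minCpoly_cyclotomic prim_z) (Cintr_Cyclotomic prim_z).
have /Pdiv.IdomainMonic.dvdpP H := Cyclotomic_monic n.
by have [q ->] := H f dvd_Phi; exists q.
Qed.

(** The list [s] holds the exponents i with a_i = 1, together with 0 for the constant term.
    Quantifying over all primitive roots lets the relation be applied to z^u when scaling. *)
Definition root_relation (n m : nat) (s : seq nat) : Prop :=
  [/\ (0 < m < n)%N, uniq s, all (fun i => i < m)%N s, 0%N \in s
    & forall z : algC, n.-primitive_root z -> z ^+ m = \sum_(i <- s) z ^+ i].

Lemma root_relation_scale (n m u : nat) (s : seq nat) : (0 < u)%N ->
  root_relation n m s ->
  root_relation (n * u)%N (m * u)%N [seq (i * u)%N | i <- s].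
Proof.
move=> u_gt0 [m_lt_n uniq_s /allP s_lt_m s0 rel_s]; split.
- by rewrite muln_gt0 ltn_pmul2r // u_gt0 andbT.
- by rewrite map_inj_uniq // => i j /eqP; rewrite eqn_pmul2r // => /eqP.
- by rewrite all_map; apply/allP=> i /s_lt_m /=; rewrite ltn_pmul2r.
- by apply/mapP; exists 0%N.
move=> z prim_z; rewrite big_map mulnC exprM rel_s; last first.
  by have := dvdn_prim_root prim_z (dvdn_mulr u (dvdnn n)); rewrite mulKn //; lia.
by apply: eq_bigr => i _; rewrite mulnC exprM.
Qed.

Lemma root_relation_calA (n m : nat) (s : seq nat) :
  root_relation n m s -> exists2 f, calA n f & deg f = m.
Proof.
move=> [/andP[m_gt0 lt_mn] uniq_s /allP s_lt_m s0 rel_s].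
(* Sorting [s] turns its sum into one over 0 <= i < m, whose term at 0 becomes the constant -1. *)
have perm_s : perm_eq s [seq i <- index_iota 0 m | i \in s].
  apply: uniq_perm => //; first by rewrite filter_uniq ?iota_uniq.
  move=> i; rewrite mem_filter mem_index_iota /=.
  by case s_i: (i \in s); rewrite //= s_lt_m.
pose f : {poly int} := 'X^m - \sum_(i <- s) 'X^i.
exists f; last first.
  rewrite /deg size_polyDl ?size_polyXn // size_polyN ltnS.
  apply: (leq_trans (size_sum _ _ _)); apply/bigmax_leqP_seq => i s_i _.
  by rewrite size_polyXn s_lt_m.
split.
  have [|z prim_z] := @C_prim_root_exists n; first by apply: leq_ltn_trans lt_mn.
  apply: (Cyclotomic_dvd prim_z).
  rewrite /root rmorphB /= map_polyXn rmorph_sum /= hornerD hornerN hornerXn.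
  rewrite horner_sum (rel_s z prim_z) subr_eq0; apply/eqP/eq_bigr => i _.
  by rewrite map_polyXn hornerXn.
exists m, (fun i => (i \in s)%:R); split=> [|i _|]; first by rewrite m_gt0.
  by case: (i \in s); [right | left].
rewrite /f (perm_big _ perm_s) /= big_filter big_mkcond /= big_ltn // s0 expr0.
rewrite opprD addrA addrAC.
congr (_ - _ - _); apply: eq_bigr => i _.
by case: (i \in s); rewrite ?scale1r ?scale0r.
Qed.

(* [t] lists the indices that are left out. *)
Definition progression (c d r : nat) (t : seq nat) : seq nat :=
  [seq (c + d * j)%N | j <- index_iota 0 r & j \notin t].

Lemma mem_progression c d r t i :
  reflect (exists2 j, (j < r)%N && (j \notin t) & i = (c + d * j)%N)
    (i \in progression c d r t).
Proof.
apply: (iffP mapP) => [] [j Hj ->]; exists j => //.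
  by move: Hj; rewrite mem_filter mem_index_iota andbC.
by rewrite mem_filter mem_index_iota andbC.
Qed.

Lemma progression_uniq c d r t : (0 < d)%N -> uniq (progression c d r t).
Proof.
move=> d_gt0; rewrite map_inj_uniq ?filter_uniq ?iota_uniq // => i j /eqP.
by rewrite eqn_add2l eqn_pmul2l // => /eqP.
Qed.

(** The sum over all r indices is w^c times a geometric sum whose ratio w^d is an r-th root of unity
    other than 1, so it vanishes. *)
Lemma progression_sum (n c d r : nat) (t : seq nat) (w : algC) :
  n.-primitive_root w -> n = (d * r)%N -> (1 < r)%N ->
  uniq t -> all (fun j => j < r)%N t ->
  \sum_(i <- progression c d r t) w ^+ i = - \sum_(j <- t) w ^+ (c + d * j).
Proof.
move=> prim_w def_n r_gt1 uniq_t /allP t_lt_r.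
have n_gt0 := prim_order_gt0 prim_w.
have sum0 : \sum_(0 <= j < r) w ^+ (c + d * j) = 0.
  under eq_bigr => j _ do rewrite exprD exprM.
  rewrite -mulr_sumr big_mkord.
  have /eqP : (w ^+ d - 1) * \sum_(i < r) (w ^+ d) ^+ i = 0.
    by rewrite -subrX1 -exprM -def_n (prim_expr_order prim_w) subrr.
  rewrite mulf_eq0 subr_eq0 -(prim_order_dvd prim_w) => /orP[|/eqP->].
    by move/dvdn_leq; rewrite def_n; nia.
  by rewrite mulr0.
have perm_t : perm_eq t [seq j <- index_iota 0 r | j \in t].
  apply: uniq_perm => //; first by rewrite filter_uniq ?iota_uniq.
  move=> i; rewrite mem_filter mem_index_iota /=.
  by case t_i: (i \in t); rewrite //= t_lt_r.
apply/eqP; rewrite -addr_eq0 big_map big_filter addrC.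
rewrite (perm_big _ perm_t) /= big_filter.
by rewrite -(bigID (fun j => j \in t) predT) /= sum0.
Qed.

Lemma prim_root_half (R : idomainType) (h : nat) (w : R) :
  (2 * h)%N.-primitive_root w -> w ^+ h = -1.
Proof.
move=> prim_w; have h_gt0 := prim_order_gt0 prim_w.
have /eqP : (w ^+ h) ^+ 2 = 1.
  by rewrite -exprM mulnC (prim_expr_order prim_w).
rewrite sqrf_eq1 -(prim_order_dvd prim_w) => /orP[/dvdn_leq|/eqP //]; lia.
Qed.

(** The omitted index (p-1)/2 has exponent pq - q, and -w^(pq-q) = w^(2pq-q). *)
Lemma root_relation_single (p q : nat) : odd p -> (2 < p)%N -> (0 < q)%N ->
  root_relation (2 * (p * q))%N (2 * (p * q) - q)%N
    (progression 0 (2 * q) p [:: p.-1./2]).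
Proof.
move=> odd_p p_gt2 q_gt0.
have [a def_p] : exists a, p = (2 * a + 1)%N by exists p./2; lia.
have -> : p.-1./2 = a by lia.
split; first by nia.
- by apply: progression_uniq; lia.
- by apply/allP => i /mem_progression[j /andP[lt_jp _] ->] /=; nia.
- by apply/mem_progression; exists 0%N; rewrite ?inE; lia.
move=> w prim_w.
rewrite (progression_sum _ prim_w) //= ?big_seq1; [|lia|lia|lia].
have -> : (2 * (p * q) - q = p * q + (0 + 2 * q * a))%N by nia.
by rewrite exprD (prim_root_half prim_w) mulN1r.
Qed.

(** The start 2p - q represents -q modulo 2p. The omitted indices [p.-1./2], [q.-1], [q./2.-1] have
    exponents pq - q, 2pq - q, pq - p - q: the first two powers cancel, and minus the third is
    w^m. *)
Lemma root_relation_close (p q : nat) : odd p -> odd q ->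
  (2 < p)%N -> (p < q)%N -> (q < 2 * p)%N ->
  root_relation (2 * (p * q))%N (2 * (p * q) - p - q)%N
    (progression 0 (2 * q) p [:: p.-1./2]
       ++ progression (2 * p - q) (2 * p) q [:: q.-1; q./2.-1]).
Proof.
move=> odd_p odd_q p_gt2 lt_pq lt_q2p.
have [a def_p] : exists a, p = (2 * a + 1)%N by exists p./2; lia.
have [b def_q] : exists b, q = (2 * b + 3)%N by exists q./2.-1; lia.
have -> : p.-1./2 = a by lia.
have -> : q./2.-1 = b by lia.
have -> : q.-1 = (2 * b + 2)%N by lia.
split; first by nia.
- rewrite cat_uniq !progression_uniq ?andbT /=; try lia.
  apply/hasPn => i /mem_progression[j _ def_i].
  by apply/negP => /mem_progression[l _]; lia.
- rewrite all_cat; apply/andP; split.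
    apply/allP => i /mem_progression[j /andP[lt_jp _] ->].
    by have := leq_mul (leqnn q) lt_jp; lia.
  apply/allP => i /mem_progression[j]; rewrite !inE => j_bnd ->.
  (* Without the last index q - 1, the exponents are at most 2pq - 2p - q. *)
  have lt_jq : (j.+1 < q)%N by lia.
  by have := leq_mul (leqnn p) lt_jq; lia.
- rewrite mem_cat; apply/orP; left; apply/mem_progression.
  by exists 0%N; rewrite ?inE; lia.
move=> w prim_w; rewrite big_cat /=.
rewrite !(progression_sum _ prim_w) ?big_cons ?big_nil //= ?inE; try lia.
have half := prim_root_half prim_w.
have -> : (2 * p - q + 2 * p * (2 * b + 2) = p * q + (0 + 2 * q * a))%N.
  by rewrite def_p def_q; lia.
have -> : (2 * (p * q) - p - q = p * q + (2 * p - q + 2 * p * b))%N.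
  by rewrite def_p def_q; lia.
rewrite !exprD half; ring.
Qed.

(** The omitted indices [q.-1], [q./2.-1], [p.-1./2] have exponents 2pq - 2p, pq - 3p, pq - 2p: the
    first and last powers cancel, and minus the middle one is w^m. *)
Lemma root_relation_apart (p q : nat) : odd p -> odd q ->
  (2 < p)%N -> (2 * p < q)%N ->
  root_relation (2 * (p * q))%N (2 * (p * q) - 3 * p)%N
    (progression 0 (2 * p) q [:: q.-1; q./2.-1]
       ++ progression (q - 2 * p) (2 * q) p [:: p.-1./2]).
Proof.
move=> odd_p odd_q p_gt2 lt_2pq.
have [a def_p] : exists a, p = (2 * a + 1)%N by exists p./2; lia.
have [b def_q] : exists b, q = (2 * b + 3)%N by exists q./2.-1; lia.
have -> : p.-1./2 = a by lia.
have -> : q./2.-1 = b by lia.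
have -> : q.-1 = (2 * b + 2)%N by lia.
split; first by nia.
- rewrite cat_uniq !progression_uniq ?andbT /=; try lia.
  apply/hasPn => i /mem_progression[j _ def_i].
  by apply/negP => /mem_progression[l _]; lia.
- rewrite all_cat; apply/andP; split.
    apply/allP => i /mem_progression[j]; rewrite !inE => j_bnd ->.
    have lt_jq : (j.+1 < q)%N by lia.
    by have := leq_mul (leqnn p) lt_jq; lia.
  apply/allP => i /mem_progression[j /andP[lt_jp _] ->].
  by have := leq_mul (leqnn q) lt_jp; lia.
- rewrite mem_cat; apply/orP; left; apply/mem_progression.
  by exists 0%N; rewrite ?inE; lia.
move=> w prim_w; rewrite big_cat /=.
rewrite !(progression_sum _ prim_w) ?big_cons ?big_nil //= ?inE; try lia.
have half := prim_root_half prim_w.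
have -> : (0 + 2 * p * (2 * b + 2) = p * q + (q - 2 * p + 2 * q * a))%N.
  by rewrite def_p def_q; lia.
have -> : (2 * (p * q) - 3 * p = p * q + (0 + 2 * p * b))%N.
  by rewrite def_p def_q; lia.
rewrite !exprD half; ring.
Qed.

Theorem theorem3p15 (k : nat) (p : nat -> nat) (n : nat)
  (hk : (2 <= k)%N)
  (hprime : forall i : nat, (1 <= i <= k)%N -> prime (p i) /\ odd (p i))
  (hlt : forall i : nat, (1 <= i < k)%N -> (p i < p i.+1)%N)
  (hn : n = (2 * \prod_(1 <= i < k.+1) p i)%N) :
  exists d : nat,
    is_min_deg (calA n) d /\ (d%:R : rat) <= n%:R - vbound n (p 1%N) (p 2%N).
Proof.
have [pr_p1 odd_p1] : prime (p 1%N) /\ odd (p 1%N) by apply: hprime; lia.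
have [pr_p2 odd_p2] : prime (p 2%N) /\ odd (p 2%N) by apply: hprime; lia.
have lt_p12 : (p 1%N < p 2%N)%N by apply: hlt; lia.
pose u := (\prod_(3 <= i < k.+1) p i)%N.
have u_gt0 : (0 < u)%N.
  rewrite /u big_seq_cond prodn_cond_gt0 // => i /andP[].
  by rewrite mem_index_iota => i_bnd _; apply/prime_gt0/(proj1 (hprime i _)); lia.
have def_n : n = (2 * (p 1%N * p 2%N) * u)%N.
  have [lt1k lt2k] : (1 < k.+1)%N /\ (2 < k.+1)%N by lia.
  by rewrite hn (big_ltn lt1k) (big_ltn lt2k) -/u !mulnA.
have p1_gt2 : (2 < p 1%N)%N by have := prime_gt1 pr_p1; lia.
move: (p 1%N) (p 2%N) pr_p1 pr_p2 odd_p1 odd_p2 lt_p12 def_n p1_gt2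
  => a b _ _ odd_a odd_b lt_ab def_n a_gt2 {hprime hlt hn}.
have a_neq0 : (a%:R : rat) != 0 by rewrite pnatr_eq0; lia.
have b_neq0 : (b%:R : rat) != 0 by rewrite pnatr_eq0; lia.
(* Since n = 2abu, the value v is (a+b)u, 3au or bu in the three cases: u times the amount by which
   m falls short of 2ab. *)
have min_from m s : root_relation (2 * (a * b))%N m s ->
    (m * u)%:R = n%:R - vbound n a b ->
  exists d, is_min_deg (calA n) d /\ (d%:R : rat) <= n%:R - vbound n a b.
  move=> /(root_relation_scale u_gt0) /root_relation_calA [f Af deg_f] <-.
  rewrite -def_n in Af; have [d min_d le_d] := ex_min_deg Af.
  by exists d; rewrite ler_nat -deg_f.
have [lt_b2a | le_2ab] := ltnP b (2 * a).
  apply: (min_from _ _ (root_relation_close odd_a odd_b a_gt2 lt_ab lt_b2a)).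
  rewrite /vbound lt_b2a def_n -subnDA mulnBl natrB; last by nia.
  by rewrite !natrM natrD; field; rewrite b_neq0.
have [lt_b3a | le_3ab] := ltnP b (3 * a).
  have lt_2ab : (2 * a < b)%N by lia.
  apply: (min_from _ _ (root_relation_apart odd_a odd_b a_gt2 lt_2ab)).
  rewrite /vbound ltnNge le_2ab lt_b3a /= def_n mulnBl natrB; last by nia.
  by rewrite !natrM; field.
have b_gt0 : (0 < b)%N by lia.
apply: (min_from _ _ (root_relation_single odd_a a_gt2 b_gt0)).
rewrite /vbound !ltnNge le_2ab le_3ab /= def_n mulnBl natrB; last by nia.
by rewrite !natrM; field.
Qed.
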